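(* Let $n\ge d\ge 1$ be integers. Suppose that $r_1(t)>\dots>r_d(t)>0$ satisfy, at some time $t>0$, the ODE system $$\dot r_k(t)=\sum_{j\colon j\ne k}\left(\frac{1}{r_k(t)-r_j(t)}+\frac{1}{r_k(t)+r_j(t)}\right)+\frac{n+1}{r_k(t)},\qquad k=1,\dots,d.$$ Then the rectangular entropy $H(r(t))$ is strictly increasing at time $t$, i.e. $\frac{d}{dt}H(r(t))>0$ at that time.
   Context: $r(t)=(r_1(t),\dots,r_d(t))$, a dot denotes the derivative in $t$, and sums over $j$ range over $j\in\{1,\dots,d\}\setminus\{k\}$. The rectangular entropy is $$H(r)=\log\left[\left(\prod_{i=1}^d r_i^{\,n+1}\right)\prod_{1\le i<j\le d}(r_i-r_j)(r_i+r_j)\right],\qquad r_1>\dots>r_d>0.$$ *)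

(* Defs.v *)
From HB Require Import structures.
From mathcomp Require Import all_boot all_order all_algebra.
From mathcomp Require Import all_classical all_reals all_analysis.

Set Implicit Arguments.
Unset Strict Implicit.
Unset Printing Implicit Defensive.

Import Order.TTheory GRing.Theory Num.Theory.
Import numFieldNormedType.Exports.

Local Open Scope ring_scope.

(* Coordinates r_1, ..., r_d are indexed from 0: r_k is [x] at the ordinal
   k - 1 of ['I_d]. *)

(* r_1 > ... > r_d > 0 *)
Definition decreasing_pos (R : realType) (d : nat) (x : 'I_d -> R) : Prop :=
  (forall i j : 'I_d, (i < j)%N -> x j < x i) /\ (forall i : 'I_d, 0 < x i).

(* [ln] is 0 on nonpositive reals; on [decreasing_pos] points the argument is
   positive. *)
Definition rect_entropy (R : realType) (n d : nat) (x : 'I_d -> R) : R :=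
  ln ((\prod_(i < d) x i ^+ n.+1) *
      \prod_(i < d) \prod_(j < d | (i < j)%N) ((x i - x j) * (x i + x j))).

Definition rect_drift (R : realType) (n d : nat) (x : 'I_d -> R) (k : 'I_d)
    : R :=
  \sum_(j < d | j != k) ((x k - x j)^-1 + (x k + x j)^-1) + n.+1%:R / x k.

(* Main.v *)
Require Import Defs.
From HB Require Import structures.
From mathcomp Require Import all_boot all_order all_algebra.
From mathcomp Require Import all_classical all_reals all_analysis.
From mathcomp Require Import ring.

Import Order.TTheory GRing.Theory Num.Theory.
Import numFieldNormedType.Exports.

Local Open Scope ring_scope.

(** The reason is that the ODE is the gradient flow of [H]: since
    [log (r_i - r_j)] has partial derivatives [1 / (r_i - r_j)] in [r_i] and
    [1 / (r_j - r_i)] in [r_j], collecting all contributions to the [k]-th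
    variable gives exactly the drift [b_k], i.e. [grad H = b].  Along a
    solution, [dH/dt = \sum_k (grad H)_k b_k = \sum_k b_k ^ 2 >= 0].
    The inequality is strict because the drift of the largest coordinate
    is a sum of nonnegative terms and of [(n + 1) / r_1 > 0].

    Since [H] is the logarithm of a product, its derivative is computed by
    logarithmic differentiation ([has_logderiv_prod]).  This produces one term
    for each pair [i < j], carrying the velocities of both coordinates, while
    the drift is indexed by ordered pairs; [sum_offdiag_pair] reconciles the
    two, which gives the chain rule [is_derive_rect_entropy]. *)

(** The function is required to be positive at the point so that the notion is
    stable under products and determines the derivative of its logarithm. *)
Definition has_logderiv {R : realType} (f : R -> R) (t l : R) : Prop :=
  0 < f t /\ is_derive t 1 f (f t * l).

Lemma has_logderivI {R : realType} {f : R -> R} {t v : R} :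
  0 < f t -> is_derive t 1 f v -> has_logderiv f t (v / f t).
Proof.
move=> f0 fv; split=> //; apply: (is_derive_eq fv).
by rewrite mulrCA divff ?mulr1 // gt_eqF.
Qed.

Lemma has_logderiv1 {R : realType} (t : R) : has_logderiv (fun=> 1) t 0.
Proof. by split; [exact: ltr01 | rewrite mulr0; exact: is_derive_cst]. Qed.

Lemma has_logderivM {R : realType} {f g : R -> R} {t l m : R} :
  has_logderiv f t l -> has_logderiv g t m ->
  has_logderiv (fun s => f s * g s) t (l + m).
Proof.
move=> [f0 df] [g0 dg]; split; first exact: mulr_gt0.
apply: (is_derive_eq (is_deriveM df dg)).
by rewrite /GRing.scale /=; ring.
Qed.

Lemma has_logderiv_prod {R : realType} {I : Type} (s : seq I) (P : pred I)
    {f : I -> R -> R} {t : R} {l : I -> R} :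
  (forall i, P i -> has_logderiv (f i) t (l i)) ->
  has_logderiv (fun u => \prod_(i <- s | P i) f i u) t (\sum_(i <- s | P i) l i).
Proof.
move=> fl; elim: s => [|i s IHs].
  rewrite big_nil; under eq_fun do rewrite big_nil.
  exact: has_logderiv1.
rewrite big_cons; under eq_fun do rewrite big_cons.
by case: ifPn => // Pi; apply: has_logderivM => //; exact: fl.
Qed.

Lemma has_logderivX {R : realType} {f : R -> R} {t l : R} (n : nat) :
  has_logderiv f t l -> has_logderiv (fun s => f s ^+ n) t (l *+ n).
Proof.
move=> fl; elim: n => [|n IHn].
  by under eq_fun do rewrite expr0; rewrite mulr0n; exact: has_logderiv1.
by under eq_fun do rewrite exprS; rewrite mulrS; exact: has_logderivM.
Qed.

Lemma is_derive_ln_logderiv {R : realType} {f : R -> R} {t l : R} :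
  has_logderiv f t l -> is_derive t 1 (fun s => ln (f s)) l.
Proof.
move=> [f0 df].
apply: (is_derive_eq (is_derive1_comp (is_derive1_ln f0) df)).
by rewrite mulrA mulVf ?mul1r // gt_eqF.
Qed.

Lemma sum_offdiag_pair {V : nmodType} {d : nat} (F : 'I_d -> 'I_d -> V) :
  \sum_(i < d) \sum_(j < d | j != i) F i j =
  \sum_(i < d) \sum_(j < d | (i < j)%N) (F i j + F j i).
Proof.
under [RHS]eq_bigr do rewrite big_split /=.
rewrite big_split /=.
have -> : \sum_(i < d) \sum_(j < d | (i < j)%N) F j i =
          \sum_(i < d) \sum_(j < d | (j < i)%N) F i j.
  by rewrite (exchange_big_dep xpredT).
rewrite -big_split; apply: eq_bigr => i _ /=.
rewrite (bigID (fun j : 'I_d => (i < j)%N)) /=; congr (_ + _);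
  apply: eq_bigl => j; rewrite -val_eqE /= neq_ltn;
  by case: ltngtP.
Qed.

(** The chain rule for [H] with the identity [grad H = b] built in.  The velocity
    [v] is arbitrary, so only the gradient is used here; the ODE enters when
    [v] is taken to be the drift. *)
Lemma is_derive_rect_entropy {R : realType} (n : nat) {d : nat} {r : R -> 'I_d -> R}
    {t : R} {v : 'I_d -> R} :
  decreasing_pos (r t) ->
  (forall k, is_derive t 1 (fun s => r s k) (v k)) ->
  is_derive t 1 (fun s => rect_entropy n (r s))
    (\sum_(k < d) v k * rect_drift n (r t) k).
Proof.
move=> [rdec rpos] dr; rewrite /rect_entropy.
have lpow : has_logderiv (fun s => \prod_(i < d) r s i ^+ n.+1) t
    (\sum_(i < d) (v i / r t i) *+ n.+1).
  apply: has_logderiv_prod => i _; apply: has_logderivX.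
  exact: (has_logderivI (rpos i) (dr i)).
have lpair : has_logderiv (fun s => \prod_(i < d) \prod_(j < d | (i < j)%N)
      ((r s i - r s j) * (r s i + r s j))) t
    (\sum_(i < d) \sum_(j < d | (i < j)%N)
      ((v i - v j) / (r t i - r t j) + (v i + v j) / (r t i + r t j))).
  apply: has_logderiv_prod => i _; apply: has_logderiv_prod => j ij.
  apply: has_logderivM.
  (* The derivative premises are found by instance resolution from [dr]. *)
  - by apply: (has_logderivI (f := fun s => r s i - r s j)); rewrite subr_gt0 rdec.
  - by apply: (has_logderivI (f := fun s => r s i + r s j)); rewrite addr_gt0.
apply: (is_derive_eq (is_derive_ln_logderiv (has_logderivM lpow lpair))).
under [RHS]eq_bigr do rewrite mulrDr addrC mulr_sumr.
rewrite big_split /= sum_offdiag_pair; congr (_ + _).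
  by apply: eq_bigr => i _; rewrite -mulr_natr; ring.
apply: eq_bigr => i _; apply: eq_bigr => j _.
(* Swapping [i] and [j] changes the sign of [r_i - r_j] and fixes
   [r_i + r_j], which matches the opposite sign of [v_j] in [v_i - v_j]. *)
by rewrite -(opprB (r t i)) invrN (addrC (r t j)); ring.
Qed.

(** The repulsion terms of the largest coordinate all push it upwards; for the
    other coordinates the drift may have any sign. *)
Lemma rect_drift_largest_gt0 {R : realType} (n : nat) {d : nat} {x : 'I_d -> R}
    {k : 'I_d} :
  decreasing_pos x -> k = 0%N :> nat -> 0 < rect_drift n x k.
Proof.
move=> [xdec xpos] k0.
apply: ltr_wpDl; last by rewrite divr_gt0 ?ltr0n.
apply: sumr_ge0 => j jk.
have xjk : x j < x k by apply: xdec; rewrite k0 lt0n -k0.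
by rewrite addr_ge0 // invr_ge0 ?subr_ge0 ltW // addr_gt0.
Qed.

Theorem corollary3p1 (R : realType) (n d : nat) (hd : (1 <= d)%N)
    (hnd : (d <= n)%N) (r : R -> 'I_d -> R) (t : R) (ht : 0 < t)
    (hr : decreasing_pos (r t))
    (hode : forall k : 'I_d,
        is_derive t 1 (fun s : R => r s k) (rect_drift n (r t) k)) :
  derivable (fun s : R => rect_entropy n (r s)) t 1 /\
  0 < derive1 (fun s : R => rect_entropy n (r s)) t.
Proof.
have dH := is_derive_rect_entropy n hr hode.
split; first exact: ex_derive.
rewrite derive1E derive_val (bigD1 (Ordinal hd)) //=.
apply: ltr_pwDl; last by apply: sumr_ge0 => k _; rewrite -expr2 sqr_ge0.
by rewrite mulr_gt0 //; exact: rect_drift_largest_gt0.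
Qed.
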